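(* Let $(X,d)$ be a metric space, let $p\in X$, and let $D=X\setminus\{p\}$. Then for all $x,y\in D$, $$j_p(x,y)\le \tau_p(x,y)\le 2\,j_p(x,y).$$ Moreover, both inequalities are sharp for $D=\mathbb{R}^n\setminus\{0\}$ (that is, $X=\mathbb{R}^n$ with the Euclidean metric, $n\ge 2$, and $p=0$): the constant $1$ in the left inequality cannot be replaced by any larger constant and the constant $2$ in the right inequality cannot be replaced by any smaller constant.
   Context: For a metric space $(X,d)$ and $p\in X$, the scale-invariant Cassinian metric on $X\setminus\{p\}$ is $$\tau_p(x,y)=\log\left(1+2\frac{d(x,y)}{\sqrt{d(x,p)\,d(y,p)}}\right),\quad x,y\in X\setminus\{p\}.$$ The distance ratio metric $j$ (Gehring–Osgood form) of $X\setminus\{p\}$ is $$j_p(x,y)=\frac12\log\left[\left(1+\frac{d(x,y)}{d(x,p)}\right)\left(1+\frac{d(x,y)}{d(y,p)}\right)\right],\quad x,y\in X\setminus\{p\}.$$ *)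

(* Defs.v *)
From HB Require Import structures.
From mathcomp Require Import all_boot all_order all_algebra.
From mathcomp Require Import all_classical all_reals all_analysis.
From mathcomp Require Import ring lra.

Set Implicit Arguments.
Unset Strict Implicit.
Unset Printing Implicit Defensive.

Import Order.TTheory GRing.Theory Num.Theory.

Local Open Scope ring_scope.

Section cassinian.
Context {R : realType} {X : metricType R}.
Implicit Types p x y : X.

Definition cassinian p x y : R :=
  ln (1 + 2 * (mdist x y / Num.sqrt (mdist x p * mdist y p))).

Definition dist_ratio p x y : R :=
  2^-1 * ln ((1 + mdist x y / mdist x p) * (1 + mdist x y / mdist y p)).

End cassinian.

(* The library's norm and topology on 'rV[R]_n are those of the sup norm, so
   R^n with its Euclidean metric is set up on an alias. *)
Definition euclidean (R : realType) (n : nat) : Type := 'rV[R]_n.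

HB.instance Definition _ (R : realType) (n : nat) :=
  GRing.Lmodule.on (euclidean R n).

Section euclidean_metric.
Context {R : realType} {n : nat}.
Implicit Types x y z : euclidean R n.

Definition euclid_dist x y : R := Num.sqrt (\sum_(i < n) (x 0 i - y 0 i) ^+ 2).

Lemma cauchy_schwarz_sum (a b : 'I_n -> R) :
  (\sum_i a i * b i) ^+ 2 <= (\sum_i a i ^+ 2) * (\sum_i b i ^+ 2).
Proof.
set A := \sum_i a i ^+ 2; set B := \sum_i b i ^+ 2; set C := \sum_i a i * b i.
have A_ge0 : 0 <= A by apply: sumr_ge0 => i _; exact: sqr_ge0.
have [A0|A_neq0] := eqVneq A 0.
  suff -> : C = 0 by rewrite A0 mul0r expr0n.
  apply: big1 => i _; suff -> : a i = 0 by rewrite mul0r.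
  have a2_ge0 j : true -> 0 <= a j ^+ 2 by move=> _; exact: sqr_ge0.
  have := psumr_eq0P a2_ge0 A0; move=> /(_ i isT)/eqP.
  by rewrite sqrf_eq0 => /eqP.
have A_gt0 : 0 < A by rewrite lt_def A_neq0.
rewrite -subr_ge0 -(pmulr_rge0 _ A_gt0).
have -> : A * (A * B - C ^+ 2) = \sum_i (A * b i - C * a i) ^+ 2.
  transitivity (A ^+ 2 * B + (- 2 * A * C) * C + C ^+ 2 * A); first by ring.
  rewrite [A ^+ 2 * B]mulr_sumr [- 2 * A * C * C]mulr_sumr.
  rewrite [C ^+ 2 * A]mulr_sumr -!big_split /=.
  by apply: eq_bigr => i _; ring.
by apply: sumr_ge0 => i _; exact: sqr_ge0.
Qed.

Lemma euclid_distxx x : euclid_dist x x = 0.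
Proof.
rewrite /euclid_dist big1 ?sqrtr0 // => i _.
by rewrite subrr expr0n.
Qed.

Lemma euclid_dist_positivity x y : euclid_dist x y = 0 -> x = y.
Proof.
move=> /eqP; rewrite sqrtr_eq0 => le0.
have d2_ge0 (i : 'I_n) : true -> 0 <= (x 0 i - y 0 i) ^+ 2.
  by move=> _; exact: sqr_ge0.
have /(psumr_eq0P d2_ge0) d0 : \sum_(i < n) (x 0 i - y 0 i) ^+ 2 = 0.
  by apply/eqP; rewrite eq_le le0 sumr_ge0.
apply/rowP => i; apply/eqP.
by rewrite -subr_eq0 -sqrf_eq0 d0.
Qed.

Lemma euclid_dist_sym x y : euclid_dist x y = euclid_dist y x.
Proof. by congr Num.sqrt; apply: eq_bigr => i _; rewrite -sqrrN opprB. Qed.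

Lemma euclid_dist_triangle y x z :
  euclid_dist x z <= euclid_dist x y + euclid_dist y z.
Proof.
have sum_ge0 (c : 'I_n -> R) : 0 <= \sum_i c i ^+ 2.
  by apply: sumr_ge0 => i _; exact: sqr_ge0.
have rhs_ge0 : 0 <= euclid_dist x y + euclid_dist y z.
  by rewrite addr_ge0 ?sqrtr_ge0.
rewrite -(ger0_norm rhs_ge0) -sqrtr_sqr ler_sqrt ?sqr_ge0 //.
rewrite sqrrD !sqr_sqrtr //.
set a := fun i => x 0 i - y 0 i; set b := fun i => y 0 i - z 0 i.
have -> : \sum_i (x 0 i - z 0 i) ^+ 2 =
    \sum_i a i ^+ 2 + (\sum_i a i * b i) *+ 2 + \sum_i b i ^+ 2.
  rewrite -sumrMnl -!big_split /=; apply: eq_bigr => i _.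
  by rewrite /a /b; ring.
rewrite lerD2r lerD2l lerMn2r /= -sqrtrM //.
apply: le_trans (ler_norm _) _; rewrite -sqrtr_sqr ler_sqrt ?mulr_ge0 //.
exact: cauchy_schwarz_sum.
Qed.

End euclidean_metric.

HB.instance Definition _ (R : realType) (n : nat) :=
  @isMetric.Build R (euclidean R n) euclid_dist euclid_distxx
    euclid_dist_positivity euclid_dist_sym euclid_dist_triangle.

(* Main.v *)
(** Write [a = d(x,p)], [b = d(y,p)], [t = d(x,y)].  After exponentiation the left
inequality reduces to [a + b <= 4 sqrt(ab) + 3 t], which follows from
[a + b <= 2 min(a,b) + t], and the right one to [2 sqrt(ab) <= a + b].
Both constants are sharp already along a ray: for [x = e] and [y = s^2 e] with
[e] a unit vector and [s > 1], one has [tau = ln (1 + 2 (s - 1/s))] and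
[j = ln (2 s^2 - 1) / 2]; the ratio [tau / j] tends to 1 as [s] tends to infinity
and to 2 as [s] tends to 1. *)
Require Import Defs.
From mathcomp Require Import all_boot all_order all_algebra.
From mathcomp Require Import all_classical all_reals all_analysis.
From mathcomp Require Import ring lra.

Import Order.TTheory GRing.Theory Num.Theory.

Local Open Scope ring_scope.

Lemma half_ln_le (R : realType) (u v : R) :
  0 < u -> 0 < v -> u <= v ^+ 2 -> 2^-1 * ln u <= ln v.
Proof.
move=> u0 v0 uv.
have : ln u <= ln (v ^+ 2) by rewrite ler_ln ?posrE ?exprn_gt0.
by rewrite lnXn// mulr2n; lra.
Qed.

(** Here [u] and [v] are the arguments of the logarithms in [cassinian] and [dist_ratio]. The bound
    [v <= u ^+ 2] yields the left inequality and [u <= v] the right one; the bounds by 1 keep both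
    logarithms defined. *)
Lemma cassinian_bounds (R : realType) (a b t : R) :
  0 < a -> 0 < b -> 0 <= t -> a <= b + t -> b <= a + t ->
  let u := 1 + 2 * (t / Num.sqrt (a * b)) in
  let v := (1 + t / a) * (1 + t / b) in
  [/\ 1 <= u, 1 <= v, v <= u ^+ 2 & u <= v].
Proof.
move=> a0 b0 t0 ab ba u v; rewrite {}/u {}/v.
have ab0 : 0 < a * b by exact: mulr_gt0.
set s := Num.sqrt (a * b).
have s0 : 0 < s by rewrite sqrtr_gt0.
have sE : s ^+ 2 = a * b by rewrite sqr_sqrtr// ltW.
(* Over the common denominator [s ^+ 2], each comparison reduces to a linear one in [a], [b], [s],
   [t]. *)
have hv : (1 + t / a) * (1 + t / b) = 1 + t * (a + b + t) / s ^+ 2.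
  by rewrite sE; field; rewrite !gt_eqF.
rewrite hv.
have s2 : 2 * s <= a + b by have := sqr_ge0 (a - b); nra.
split.
- by rewrite lerDl mulr_ge0// divr_ge0// ltW.
- by rewrite lerDl divr_ge0 ?exprn_ge0// ?mulr_ge0//; lra.
- have -> : (1 + 2 * (t / s)) ^+ 2 = 1 + t * (4 * s + 4 * t) / s ^+ 2.
    by field; rewrite gt_eqF.
  rewrite lerD2l ler_wpM2r ?invr_ge0 ?exprn_ge0 ?(ltW s0)// ler_wpM2l//.
  suff : a + b <= 2 * s + t by lra.
  (* The smaller of [a] and [b] is at most their geometric mean [s], and the larger exceeds it by at
     most [t]. *)
  have [le_ab|lt_ba] := leP a b.
    have : a <= s by nra.
    by lra.
  have : b <= s by nra.
  by lra.
- have -> : 2 * (t / s) = t * (2 * s) / s ^+ 2 by field; rewrite gt_eqF.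
  rewrite lerD2l ler_wpM2r ?invr_ge0 ?exprn_ge0 ?(ltW s0)// ler_wpM2l//; lra.
Qed.

Section ray.
Context {R : realType} {n : nat} (i0 : 'I_n).

Definition ray (a : R) : euclidean R n := a *: delta_mx 0 i0.

Lemma mdist_ray a b : mdist (ray a) (ray b) = `|a - b|.
Proof.
change (euclid_dist (ray a) (ray b) = `|a - b|).
rewrite /euclid_dist (bigD1 i0)//= big1 => [|i /negPf ii0].
  by rewrite !mxE !eqxx !mulr1 addr0 sqrtr_sqr.
by rewrite !mxE ii0 andbF !mulr0 subrr expr0n.
Qed.

Lemma ray0 : ray 0 = 0.
Proof. exact: scale0r. Qed.

Lemma mdist_ray0 a : mdist (ray a) 0 = `|a|.
Proof. by rewrite -ray0 mdist_ray subr0. Qed.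

Lemma ray_neq0 a : 0 < a -> ray a != 0.
Proof.
move=> a0; apply/eqP => e; have := mdist_ray0 a.
by rewrite e mdistxx => /esym/eqP; rewrite normr_eq0 gt_eqF.
Qed.

(** Taking the second point at distance [s ^+ 2] makes the square root rational in [s]. *)
Lemma cassinian_ray s : 1 < s ->
  cassinian (0 : euclidean R n) (ray 1) (ray (s ^+ 2)) = ln (1 + 2 * (s - s^-1)).
Proof.
move=> s1; rewrite /cassinian mdist_ray !mdist_ray0 normr1 mul1r.
rewrite (ger0_norm (sqr_ge0 s)) sqrtr_sqr (@gtr0_norm _ s); last lra.
rewrite ltr0_norm; last nra.
by congr (ln (1 + 2 * _)); field; apply/eqP; lra.
Qed.

Lemma dist_ratio_ray s : 1 < s ->
  dist_ratio (0 : euclidean R n) (ray 1) (ray (s ^+ 2)) =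
  2^-1 * ln (2 * s ^+ 2 - 1).
Proof.
move=> s1; rewrite /dist_ratio mdist_ray !mdist_ray0 normr1.
rewrite (ger0_norm (sqr_ge0 s)) ltr0_norm; last nra.
by congr (_ * ln _); field; apply/eqP; lra.
Qed.

End ray.

(** For large [s] both metrics grow like [ln s]: the left side is at least [c * ln s] when [c > 1],
    the right side at most [ln 3 + ln s]. *)
Lemma left_constant_sharp (R : realType) (c : R) :
  (forall s, 1 < s -> c * (2^-1 * ln (2 * s ^+ 2 - 1)) <= ln (1 + 2 * (s - s^-1))) ->
  c <= 1.
Proof.
move=> h; rewrite leNgt; apply/negP => c1.
have ln3 : 0 < ln (3 : R) by rewrite ln_gt0//; lra.
(* Chosen so that [(c - 1) * k] exceeds [ln 3]; [k] will be [ln s]. *)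
pose k : R := ln 3 / (c - 1) + 1.
have k0 : 0 < k by rewrite addr_gt0// divr_gt0//; lra.
have ck : (c - 1) * k = ln 3 + (c - 1) by rewrite /k; field; apply/eqP; lra.
pose s := expR k.
have s1 : 1 < s by rewrite expR_gt1.
have sV : 0 < s^-1 by rewrite invr_gt0; lra.
have sV1 : s^-1 < 1 by rewrite invf_lt1//; lra.
have lnsE : ln s = k by rewrite expRK.
have j_ge : k <= 2^-1 * ln (2 * s ^+ 2 - 1).
  have : ln (s ^+ 2) <= ln (2 * s ^+ 2 - 1) by rewrite ler_ln ?posrE; nra.
  by rewrite lnXn ?expR_gt0// lnsE mulr2n; lra.
have tau_le : ln (1 + 2 * (s - s^-1)) <= ln 3 + k.
  by rewrite -lnsE -lnM ?posrE ?ler_ln ?posrE; lra.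
have := h s s1; nra.
Qed.

(** Linear bounds on the logarithms near [s = 1], in terms of [w = s ^+ 2 - 1], give
    [2 <= c * (s + 2 * w)], whose right side tends to [c]. *)
Lemma right_constant_sharp (R : realType) (c : R) :
  (forall s, 1 < s -> ln (1 + 2 * (s - s^-1)) <= c * (2^-1 * ln (2 * s ^+ 2 - 1))) ->
  2 <= c.
Proof.
move=> h; rewrite leNgt; apply/negP => c2.
have bound s : 1 < s -> 0 < c /\ 2 <= c * (s + 2 * (s ^+ 2 - 1)).
  move=> s1.
  set w := s ^+ 2 - 1; have w0 : 0 < w by rewrite /w; nra.
  have j_le : ln (2 * s ^+ 2 - 1) <= 2 * w.
    have -> : 2 * s ^+ 2 - 1 = 1 + 2 * w by rewrite /w; ring.
    by apply: le_ln1Dx; lra.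
  have j_ge0 : 0 <= ln (2 * s ^+ 2 - 1) by rewrite ln_ge0//; rewrite /w in w0; lra.
  have q0 : 0 < s + 2 * w by lra.
  (* [ln v >= 1 - 1/v], obtained from [ln (1/v) <= 1/v - 1] *)
  have tau_ge : 2 * w / (s + 2 * w) <= ln (1 + 2 * (s - s^-1)).
    have -> : 1 + 2 * (s - s^-1) = (s / (s + 2 * w))^-1.
      by rewrite /w; field; rewrite -/w; apply/andP; split; apply/eqP; lra.
    rewrite lnV ?posrE ?divr_gt0//; last lra.
    have e : s / (s + 2 * w) = 1 + - (2 * w / (s + 2 * w)).
      by field; apply/eqP; lra.
    have : ln (s / (s + 2 * w)) <= - (2 * w / (s + 2 * w)).
      rewrite {1}e; apply: le_ln1Dx.
      have : 0 < s / (s + 2 * w) by rewrite divr_gt0//; lra.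
      by rewrite e; lra.
    by lra.
  have tau_gt0 : 0 < 2 * w / (s + 2 * w) by rewrite divr_gt0//; lra.
  have := h s s1 => hs.
  have c0 : 0 < c by nra.
  split=> //.
  have : 2 * w / (s + 2 * w) <= c * w by nra.
  by rewrite ler_pdivrMr//; nra.
have [c0 _] := bound 2 ltac:(lra).
(* At [s = 1 + d] with [d < 1], the factor [s + 2 * (s ^+ 2 - 1)] equals [1 + 5 * d + 2 * d ^+ 2],
   at most [1 + 7 * d]. As [0 < c < 2], this forces [2 - c < 14 * d], against [2 - c = 28 * d]. *)
pose d := (2 - c) / 28.
have [|_] := bound (1 + d); first by rewrite /d; lra.
have dE : 2 - c = 28 * d by rewrite /d; field.
have d0 : 0 < d by rewrite /d; lra.
have d1 : d < 1 by rewrite /d; lra.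
nra.
Qed.

Theorem theorem3p5 (R : realType) :
  (forall (X : metricType R) (p x y : X), x != p -> y != p ->
     dist_ratio p x y <= cassinian p x y /\
     cassinian p x y <= 2 * dist_ratio p x y) /\
  (forall n : nat, (2 <= n)%N ->
     (forall c : R,
        (forall x y : euclidean R n, x != 0 -> y != 0 ->
           c * dist_ratio (0 : euclidean R n) x y <=
           cassinian (0 : euclidean R n) x y) -> c <= 1) /\
     (forall c : R,
        (forall x y : euclidean R n, x != 0 -> y != 0 ->
           cassinian (0 : euclidean R n) x y <=
           c * dist_ratio (0 : euclidean R n) x y) -> 2 <= c)).
Proof.
split=> [X p x y xp yp|n n2].
  have xp0 : 0 < mdist x p by rewrite mdist_gt0.
  have yp0 : 0 < mdist y p by rewrite mdist_gt0.
  have tri1 : mdist x p <= mdist y p + mdist x y.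
    by rewrite addrC; exact: metric_triangle.
  have tri2 : mdist y p <= mdist x p + mdist x y.
    by rewrite addrC (metric_sym x y); exact: metric_triangle.
  have [u1 v1 vu uv] := cassinian_bounds _ _ _ _ xp0 yp0 (mdist_ge0 x y) tri1 tri2.
  rewrite /cassinian /dist_ratio; split; first by apply: half_ln_le => //; lra.
  by rewrite mulVKf// ler_ln ?posrE//; lra.
pose i0 : 'I_n := Ordinal (ltnW n2).
split=> c h; [apply: left_constant_sharp|apply: right_constant_sharp] => s s1.
  rewrite -(cassinian_ray i0)// -(dist_ratio_ray i0)//.
  by apply: h; apply: ray_neq0; nra.
rewrite -(cassinian_ray i0)// -(dist_ratio_ray i0)//.
by apply: h; apply: ray_neq0; nra.
Qed.
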